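(* Fix $N,K,b\in\mathbb{N}$ (all $\ge 1$), $Z_0>0$, $P_T>0$, $\sigma^2>0$, $c>0$, a channel matrix $\mathbf{H}=[\mathbf{h}_1,\dots,\mathbf{h}_K]^H\in\mathbb{C}^{K\times N}$, and a set $\mathcal{D}$ of disconnected port pairs with complement $\mathcal{E}$ as in the context. Let $(\mathrm{D})$ be the discrete problem and, for $\rho>0$, let $(\mathrm{C}_\rho)$ be the continuous penalty problem, both defined in the context. Then there exists a constant $\bar\rho>0$ such that, for any $\rho>\bar\rho$, problems $(\mathrm{D})$ and $(\mathrm{C}_\rho)$ are globally equivalent, in the following sense: (i) any optimal solution of $(\mathrm{D})$ is also an optimal solution of $(\mathrm{C}_\rho)$; (ii) conversely, any optimal solution of $(\mathrm{C}_\rho)$ satisfies $\bar B_{i,j}^{(\ell)}\in\{-c,c\}$ for all $(i,j)\in\mathcal{E}$ and all $\ell=1,\dots,b$, and is also an optimal solution of $(\mathrm{D})$.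
   Context: **Ports.** There are $N+K$ ports; ports $1,\dots,K$ are input ports and ports $K+1,\dots,K+N$ are output ports. $\mathcal{D}\subseteq\{(i,j): 1\le i,j\le N+K,\ i\ne j\}$ is a given set of disconnected port pairs, symmetric in the sense that $(i,j)\in\mathcal{D}$ iff $(j,i)\in\mathcal{D}$. Put $\mathcal{E}=\{(i,j): 1\le i,j\le N+K\}\setminus\mathcal{D}$ (so all self-pairs $(i,i)$ belong to $\mathcal{E}$). Standing assumption: at least one input port is connected to an output port, i.e. there are $k_0\in\{1,\dots,K\}$ and $r_0\in\{K+1,\dots,K+N\}$ with $(k_0,r_0)\in\mathcal{E}$. **Notation.** $\mathrm{i}$ is the imaginary unit. $\bar{\mathbf I}_1=\begin{bmatrix}\mathbf I_K\\ \mathbf 0_{N\times K}\end{bmatrix}\in\mathbb{R}^{(N+K)\times K}$ and $\bar{\mathbf I}_2=[\mathbf 0_{N\times K}\ \ \mathbf I_N]\in\mathbb{R}^{N\times (N+K)}$. For $\bar{\mathbf F}\in\mathbb{C}^{(N+K)\times K}$ with columns $\bar{\mathbf f}_1,\dots,\bar{\mathbf f}_K$ and $\mathbf p\in\mathbb{R}^K$ with $\mathbf p\ge\mathbf 0$, the sum rate is $$R(\mathbf p,\bar{\mathbf F};\mathbf H)=\sum_{k=1}^K\log_2\left(1+\frac{|\mathbf h_k^H\bar{\mathbf I}_2\bar{\mathbf f}_k|^2p_k}{\sum_{j\ne k}|\mathbf h_k^H\bar{\mathbf I}_2\bar{\mathbf f}_j|^2p_j+\sigma^2}\right).$$ **Variables.**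 $\mathbf p\in\mathbb{R}^K$, $\bar{\mathbf F}\in\mathbb{C}^{(N+K)\times K}$, $\mathbf B\in\mathbb{R}^{(N+K)\times(N+K)}$, real numbers $\bar B_{i,j}$ ($1\le i,j\le N+K$), and real numbers $\bar B_{i,j}^{(\ell)}$ ($(i,j)\in\mathcal{E}$, $\ell=1,\dots,b$). **Common constraints.** 1. $\mathrm{i}Z_0\mathbf B(\bar{\mathbf F}+\bar{\mathbf I}_1)=\bar{\mathbf I}_1-\bar{\mathbf F}$; 2. $[\mathbf B]_{i,j}=-\bar B_{i,j}$ for $i\ne j$, and $[\mathbf B]_{i,i}=\bar B_{i,i}+\sum_{n\ne i}\bar B_{i,n}$; 3. $\bar B_{i,j}=0$ for all $(i,j)\in\mathcal{D}$; 4. $\bar B_{i,j}=\sum_{\ell=1}^b2^{\ell-1}\bar B_{i,j}^{(\ell)}$ for all $(i,j)\in\mathcal{E}$; 5. $\bar B_{j,i}^{(\ell)}=\bar B_{i,j}^{(\ell)}$ for all $(i,j)\in\mathcal{E}$, $\ell=1,\dots,b$; 6. $\mathbf 1^T\mathbf p\le P_T$ and $\mathbf p\ge\mathbf 0$. **Discrete problem $(\mathrm{D})$.** Maximize $R(\mathbf p,\bar{\mathbf F};\mathbf H)$ over all the variables subject to constraints 1–6 and $\bar B_{i,j}^{(\ell)}\in\{-c,c\}$ for all $(i,j)\in\mathcal{E}$, $\ell=1,\dots,b$. **Penalty problem $(\mathrm{C}_\rho)$.** Maximize $$R(\mathbf p,\bar{\mathbf F};\mathbf H)+\frac{\rho}{2}\sum_{\ell=1}^b\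 \sum_{(i,j)\in\mathcal{E},\,j\ge i}\left(\left(\bar B_{i,j}^{(\ell)}\right)^2-c^2\right)$$ over all the variables subject to constraints 1–6 and $\bar B_{i,j}^{(\ell)}\in[-c,c]$ for all $(i,j)\in\mathcal{E}$, $\ell=1,\dots,b$. *)

(* Defs.v *)
From HB Require Import structures.
From mathcomp Require Import all_boot all_order all_algebra.
From mathcomp Require Import reals exp.
From mathcomp Require Import complex.

Set Implicit Arguments.
Unset Strict Implicit.
Unset Printing Implicit Defensive.

Import Order.TTheory GRing.Theory Num.Theory.

Local Open Scope ring_scope.

(* Ports are indexed by 'I_(K + N): the inputs are lshift N k (k : 'I_K), the
   outputs are rshift K r (r : 'I_N).  All indices are shifted down by one. *)

Definition connected (N K : nat) (D : {set 'I_(K + N) * 'I_(K + N)}) :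
    {set 'I_(K + N) * 'I_(K + N)} :=
  ~: D.

Definition conn_pair (N K : nat) (D : {set 'I_(K + N) * 'I_(K + N)}) :=
  {ij : 'I_(K + N) * 'I_(K + N) | ij \in connected D}.

(* The field bits exists on connected pairs only, like the variables
   \bar B_{i,j}^{(l)}. *)
Record point (R : realType) (N K b : nat)
    (D : {set 'I_(K + N) * 'I_(K + N)}) := Point {
  power : 'cV[R]_K;
  Fbar : 'M[R[i]]_(K + N, K);
  Bmx : 'M[R]_(K + N);
  Bbar : 'M[R]_(K + N);
  bits : conn_pair D -> 'I_b -> R
}.

Definition log2 (R : realType) (x : R) : R := ln x / ln 2.

Definition I1bar (R : realType) (N K : nat) : 'M[R[i]]_(K + N, K) :=
  col_mx 1%:M 0.

Definition I2bar (R : realType) (N K : nat) : 'M[R[i]]_(N, K + N) :=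
  row_mx 0 1%:M.

(* Since H = [h_1, ..., h_K]^H, the vector h_k^H is the k-th row of H. *)
Definition gain (R : realType) (N K : nat) (H : 'M[R[i]]_(K, N))
    (F : 'M[R[i]]_(K + N, K)) (k j : 'I_K) : R :=
  Normc.normc ((row k H *m I2bar R N K *m col j F) 0 0) ^+ 2.

Definition sum_rate (R : realType) (N K : nat) (sigma2 : R)
    (H : 'M[R[i]]_(K, N)) (p : 'cV[R]_K) (F : 'M[R[i]]_(K + N, K)) : R :=
  \sum_(k < K) log2 (1 + gain H F k k * p k 0
    / (\sum_(j < K | j != k) gain H F k j * p j 0 + sigma2)).

Section Problems.
Variables (R : realType) (N K b : nat) (Z0 PT sigma2 c : R).
Variables (H : 'M[R[i]]_(K, N)) (D : {set 'I_(K + N) * 'I_(K + N)}).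

Implicit Types x : point R b D.

Record common_constraints x : Prop := CommonConstraints {
  network_eq :
    ('i%C * (Z0%:C)%C) *:
      (map_mx (real_complex R) (Bmx x) *m (Fbar x + I1bar R N K))
    = I1bar R N K - Fbar x;
  Bmx_offdiag : forall i j, i != j -> Bmx x i j = - Bbar x i j;
  Bmx_diag : forall i,
    Bmx x i i = Bbar x i i + \sum_(n | n != i) Bbar x i n;
  Bbar_disconnected : forall i j, (i, j) \in D -> Bbar x i j = 0;
  (* l starts at 0 here, so the weight 2^(l-1) becomes 2^l. *)
  Bbar_bits : forall e : conn_pair D,
    Bbar x (val e).1 (val e).2 = \sum_(l < b) 2 ^+ l * bits x e l;
  bits_sym : forall (e e' : conn_pair D) (l : 'I_b),
    val e' = ((val e).2, (val e).1) -> bits x e' l = bits x e l;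
  power_budget : \sum_(k < K) power x k 0 <= PT;
  power_ge0 : forall k, 0 <= power x k 0
}.

Definition bits_binary x : Prop :=
  forall (e : conn_pair D) (l : 'I_b), bits x e l = - c \/ bits x e l = c.

Definition bits_boxed x : Prop :=
  forall (e : conn_pair D) (l : 'I_b), - c <= bits x e l <= c.

Definition feasibleD x : Prop := common_constraints x /\ bits_binary x.

Definition feasibleC x : Prop := common_constraints x /\ bits_boxed x.

Definition objectiveD x : R := sum_rate sigma2 H (power x) (Fbar x).

Definition objectiveC (rho : R) x : R :=
  objectiveD x + rho / 2 *
    \sum_(l < b) \sum_(e : conn_pair D | ((val e).1 <= (val e).2)%N)
      (bits x e l ^+ 2 - c ^+ 2).

Definition optimalD x : Prop :=
  feasibleD x /\ forall y, feasibleD y -> objectiveD y <= objectiveD x.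

Definition optimalC (rho : R) x : Prop :=
  feasibleC x /\
  forall y, feasibleC y -> objectiveC rho y <= objectiveC rho x.

End Problems.

(* Main.v *)
Require Import Defs.
From mathcomp Require Import all_boot all_order all_algebra.
From mathcomp Require Import reals exp.
From mathcomp Require Import complex.
From mathcomp Require Import ring lra.
Import Order.TTheory GRing.Theory Num.Theory.
Local Open Scope ring_scope.

(* Fixing the power, the rate is a Lipschitz function of the bits on the box,
   with a constant L that does not depend on the power: the network equation
   reads (1 + i Z0 B)(Fbar + I1) = 2 I1, where B is real symmetric and affine
   in the bits, and 1 + i Z0 B does not decrease the norm.  Moving every bit t
   to the endpoint of [-c, c] of its own sign costs at most L (c - |t|) of rate
   per bit, and gains rho / 2 (c^2 - t^2) >= rho / 2 c (c - |t|) of penalty.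
   Hence for rho > 2 L / c this rounding improves the penalized objective, and
   strictly so unless all bits were already binary. *)

(** * Calculus of bounded Lipschitz functions *)

Section BoundedLipschitz.
Context {R : realType} {X : Type}.
Variables (S : X -> Prop) (E : X -> X -> Prop) (d : X -> X -> R).
Hypothesis d_ge0 : forall x y, 0 <= d x y.

(* E restricts the Lipschitz estimate to related points: it will mean "with the
   same power", so that the power counts as a parameter. *)
Definition bdlip (C : R) (f : X -> R) : Prop :=
  (forall x, S x -> `|f x| <= C) /\
  (forall x y, S x -> S y -> E x y -> `|f x - f y| <= C * d x y).

(** Boundedness travels with the Lipschitz estimate because products need it: a product of unbounded
    Lipschitz functions may fail to be Lipschitz. *)
Definition bounded_lipschitz (f : X -> R) : Prop :=
  exists2 C, 0 <= C & bdlip C f.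

Lemma bdlip_le C C' f : C <= C' -> bdlip C f -> bdlip C' f.
Proof.
move=> le_C [bd lip]; split=> [x Sx|x y Sx Sy Exy].
  exact: le_trans (bd x Sx) le_C.
by apply: le_trans (lip x y Sx Sy Exy) _; rewrite ler_wpM2r.
Qed.

Lemma bounded_lipschitz_ext f g :
  (forall x, S x -> f x = g x) -> bounded_lipschitz f -> bounded_lipschitz g.
Proof.
move=> eq_fg [C C0 [bd lip]]; exists C => //.
split=> [x Sx|x y Sx Sy Exy]; first by rewrite -eq_fg // bd.
by rewrite -!eq_fg // lip.
Qed.

Lemma bounded_lipschitz_cst a : bounded_lipschitz (fun=> a).
Proof.
exists `|a|; first exact: normr_ge0.
by split=> [//|x y _ _ _]; rewrite subrr normr0 mulr_ge0.
Qed.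

Lemma bounded_lipschitzD f g : bounded_lipschitz f -> bounded_lipschitz g ->
  bounded_lipschitz (fun x => f x + g x).
Proof.
move=> [C C0 [bdf lipf]] [C' C'0 [bdg lipg]]; exists (C + C').
  exact: addr_ge0.
split=> [x Sx|x y Sx Sy Exy].
  by apply: le_trans (ler_normD _ _) _; apply: lerD; [exact: bdf|exact: bdg].
rewrite opprD addrACA mulrDl; apply: le_trans (ler_normD _ _) _.
by apply: lerD; [exact: lipf|exact: lipg].
Qed.

Lemma bounded_lipschitzM f g : bounded_lipschitz f -> bounded_lipschitz g ->
  bounded_lipschitz (fun x => f x * g x).
Proof.
move=> [C C0 [bdf lipf]] [C' C'0 [bdg lipg]].
(* The bound takes one [C * C']; the increment, split into two terms below, takes two. *)
exists (C * C' + C * C' + C * C').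
  by rewrite !addr_ge0 ?mulr_ge0.
split=> [x Sx|x y Sx Sy Exy].
  rewrite normrM; apply: (@le_trans _ _ (C * C')); last first.
    by rewrite lerDr addr_ge0 ?mulr_ge0.
  by apply: ler_pM => //; [exact: bdf|exact: bdg].
have -> : f x * g x - f y * g y = f x * (g x - g y) + (f x - f y) * g y by ring.
apply: le_trans (ler_normD _ _) _; rewrite !normrM.
have H1 : `|f x| * `|g x - g y| <= C * (C' * d x y).
  by apply: ler_pM => //; [exact: bdf|exact: lipg].
have H2 : `|f x - f y| * `|g y| <= C * d x y * C'.
  by apply: ler_pM => //; [exact: lipf|exact: bdg].
have H3 : 0 <= C * C' * d x y by rewrite !mulr_ge0.
apply: le_trans (lerD H1 H2) _; rewrite -subr_ge0.
by rewrite (_ : _ - _ = C * C' * d x y) //; ring.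
Qed.

Lemma bounded_lipschitzN f :
  bounded_lipschitz f -> bounded_lipschitz (fun x => - f x).
Proof.
move=> blf.
apply: bounded_lipschitz_ext (bounded_lipschitzM _ _ (bounded_lipschitz_cst (-1)) blf).
by move=> x _; rewrite mulN1r.
Qed.

Lemma bounded_lipschitzB f g : bounded_lipschitz f -> bounded_lipschitz g ->
  bounded_lipschitz (fun x => f x - g x).
Proof. by move=> blf /bounded_lipschitzN; apply: bounded_lipschitzD. Qed.

Lemma bounded_lipschitz_sum (I : Type) (r : seq I) (P : pred I) (f : I -> X -> R) :
  (forall i, bounded_lipschitz (f i)) ->
  bounded_lipschitz (fun x => \sum_(i <- r | P i) f i x).
Proof.
move=> blf; elim: r => [|i r IHr].
  by apply: bounded_lipschitz_ext (bounded_lipschitz_cst 0) => x _; rewrite big_nil.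
have [Pi|nPi] := boolP (P i); last first.
  by apply: bounded_lipschitz_ext IHr => x _; rewrite big_cons (negbTE nPi).
apply: bounded_lipschitz_ext (bounded_lipschitzD _ _ (blf i) IHr) => x _.
by rewrite big_cons Pi.
Qed.

(** The increment of [1 / f] is [(f y - f x) / (f x * f y)], where each reciprocal is at most
    [1 / m]. *)
Lemma bounded_lipschitzV m f : 0 < m -> (forall x, S x -> m <= f x) ->
  bounded_lipschitz f -> bounded_lipschitz (fun x => (f x)^-1).
Proof.
move=> m0 ge_m [C C0 [_ lipf]].
have f0 x : S x -> 0 < f x by move=> Sx; apply: lt_le_trans m0 (ge_m x Sx).
have fV x : S x -> 0 < (f x)^-1 <= m^-1.
  by move=> Sx; rewrite invr_gt0 f0 // lef_pV2 ?ge_m // posrE ?f0.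
have mV0 : 0 <= m^-1 by rewrite invr_ge0 ltW.
exists (m^-1 + m^-1 * m^-1 * C); first by rewrite addr_ge0 ?mulr_ge0.
split=> [x Sx|x y Sx Sy Exy].
  have /andP[fx0 fxm] := fV x Sx; rewrite (ger0_norm (ltW fx0)).
  by apply: le_trans fxm _; rewrite lerDl !mulr_ge0.
have /andP[fx0 fxm] := fV x Sx; have /andP[fy0 fym] := fV y Sy.
have -> : (f x)^-1 - (f y)^-1 = (f x)^-1 * (f y)^-1 * (f y - f x).
  by field; rewrite !gt_eqF ?f0.
rewrite normrM [`|_ * _|]ger0_norm ?mulr_ge0 ?(ltW fx0) ?(ltW fy0) //.
rewrite distrC mulrDl -[X in X <= _]add0r lerD ?mulr_ge0 // -[X in _ <= X]mulrA.
apply: ler_pM; rewrite ?mulr_ge0 ?(ltW fx0) ?(ltW fy0) //; last exact: lipf.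
by apply: ler_pM; rewrite ?(ltW fx0) ?(ltW fy0).
Qed.

(** The reason is [ln s - ln t = ln (1 + (s - t) / t) <= (s - t) / t], and dividing by [t >= 1] does
    not increase the absolute value. *)
Lemma ln_dist_le (a b : R) : 1 <= a -> 1 <= b -> `|ln a - ln b| <= `|a - b|.
Proof.
have half (s t : R) : 1 <= s -> 1 <= t -> ln s - ln t <= `|s - t|.
  move=> s1 t1; have s0 : 0 < s by apply: lt_le_trans s1.
  have t0 : 0 < t by apply: lt_le_trans t1.
  rewrite -ln_div ?posrE // (_ : s / t = 1 + (s - t) / t); last first.
    by rewrite mulrBl divff ?gt_eqF // addrC subrK.
  apply: le_trans (le_ln1Dx _) _.
    by rewrite mulrBl divff ?gt_eqF // ltrBrDl subrr divr_gt0.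
  apply: le_trans (ler_norm _) _; rewrite normrM ler_piMr //.
  by rewrite ger0_norm ?invr_ge0 ?(ltW t0) // invf_le1.
move=> a1 b1; rewrite ler_norml half // andbT lerNl opprB distrC.
exact: half.
Qed.

Lemma bounded_lipschitz_ln f : (forall x, S x -> 1 <= f x) ->
  bounded_lipschitz f -> bounded_lipschitz (fun x => ln (f x)).
Proof.
move=> f1 [C C0 [bd lip]].
(* The [+ 1] comes from bounding [|ln (f x) - ln 1|] by [|f x - 1|]. *)
exists (C + 1); first by rewrite addr_ge0.
split=> [x Sx|x y Sx Sy Exy].
  have := ln_dist_le _ 1 (f1 x Sx) (lexx _); rewrite ln1 subr0 => /le_trans; apply.
  by apply: le_trans (ler_normB _ _) _; rewrite normr1 lerD2r; apply: bd.
apply: le_trans (ln_dist_le _ _ (f1 x Sx) (f1 y Sy)) _.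
apply: le_trans (lip _ _ Sx Sy Exy) _; rewrite ler_wpM2r //.
by rewrite lerDl.
Qed.

Lemma bounded_lipschitz_uniform (I : finType) (f : I -> X -> R) :
  (forall i, bounded_lipschitz (f i)) ->
  exists2 C, 0 <= C & forall i, bdlip C (f i).
Proof.
move=> /fin_all_exists2[C C0 blf]; exists (\sum_i C i).
  exact: sumr_ge0.
move=> i; apply: bdlip_le (blf i).
by rewrite (bigD1 i) //= lerDl sumr_ge0.
Qed.

(** * A priori bound and perturbation of the skew-Hermitian system *)

(* The system says that [x + 'i y] solves [(1 + 'i z B) w = u + 'i v].  Since
   ['i z B] is skew-Hermitian, [1 + 'i z B] does not decrease the norm. *)
Section SkewSystem.
Variables (n : nat) (z : R).

Lemma skew_system_norm (B : 'M[R]_n) (x y u v : 'I_n -> R) :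
  (forall i k, B i k = B k i) ->
  (forall i, x i - z * (\sum_k B i k * y k) = u i) ->
  (forall i, y i + z * (\sum_k B i k * x k) = v i) ->
  \sum_i (x i ^+ 2 + y i ^+ 2) <= \sum_i (u i ^+ 2 + v i ^+ 2).
Proof.
move=> symB eu ev.
(* Symmetry of [B] makes the cross terms of the expanded squares cancel; what remains beyond the
   squares of [x] and [y] is itself a sum of squares. *)
have cross : \sum_i y i * (\sum_k B i k * x k)
           = \sum_i x i * (\sum_k B i k * y k).
  under eq_bigr do rewrite big_distrr; rewrite exchange_big /=.
  apply: eq_bigr => i _; rewrite big_distrr; apply: eq_bigr => k _ /=.
  by rewrite symB; ring.
rewrite -subr_ge0 -sumrB.
have -> : \sum_i (u i ^+ 2 + v i ^+ 2 - (x i ^+ 2 + y i ^+ 2)) =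
    \sum_i ((z * (\sum_k B i k * y k)) ^+ 2 + (z * (\sum_k B i k * x k)) ^+ 2)
    + 2 * z * (\sum_i y i * (\sum_k B i k * x k)
               - \sum_i x i * (\sum_k B i k * y k)).
  rewrite -sumrB big_distrr -big_split; apply: eq_bigr => i _ /=.
  by rewrite -eu -ev; ring.
by rewrite cross subrr mulr0 addr0 sumr_ge0 // => i _; rewrite addr_ge0 ?sqr_ge0.
Qed.

(** The Euclidean norm of the data is at most its l1 norm [s], and an entry of the solution is at
    most the Euclidean norm of the solution. Only squares are compared, so no root appears. *)
Lemma skew_system_bound (B : 'M[R]_n) (x y u v : 'I_n -> R) :
  (forall i k, B i k = B k i) ->
  (forall i, x i - z * (\sum_k B i k * y k) = u i) ->
  (forall i, y i + z * (\sum_k B i k * x k) = v i) ->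
  forall i, `|x i| <= \sum_k (`|u k| + `|v k|) /\
            `|y i| <= \sum_k (`|u k| + `|v k|).
Proof.
move=> symB eu ev i; set s := \sum_k (_ + _).
have s0 : 0 <= s by apply: sumr_ge0 => k _; rewrite addr_ge0.
have le_s2 : \sum_k (u k ^+ 2 + v k ^+ 2) <= s ^+ 2.
  rewrite expr2 {1}/s big_distrl /=; apply: ler_sum => k _.
  have le_s : `|u k| + `|v k| <= s.
    rewrite /s (bigD1 k) //= lerDl sumr_ge0 // => j _.
    by rewrite addr_ge0.
  apply: (@le_trans _ _ ((`|u k| + `|v k|) * (`|u k| + `|v k|))); last first.
    by rewrite ler_wpM2l // addr_ge0.
  rewrite -(real_normK (num_real (u k))) -(real_normK (num_real (v k))).
  have := normr_ge0 (u k); have := normr_ge0 (v k); nra.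
have le_i : x i ^+ 2 + y i ^+ 2 <= s ^+ 2.
  apply: le_trans (le_trans (skew_system_norm B x y u v symB eu ev) le_s2).
  rewrite (bigD1 i) //= lerDl sumr_ge0 // => j _.
  by rewrite addr_ge0 ?sqr_ge0.
have [xi2 yi2] : `|x i| ^+ 2 <= s ^+ 2 /\ `|y i| ^+ 2 <= s ^+ 2.
  rewrite !real_normK ?num_real //; have := sqr_ge0 (x i).
  by have := sqr_ge0 (y i); split; lra.
by split; rewrite -(@ler_pXn2r _ 2) // nnegrE.
Qed.

(** The data [u], [v] are the same for all [q], so the difference of the solutions at [q] and [q']
    solves the system of [B q] with data proportional to [B q - B q']. The a priori bound applies to
    this difference. *)
Lemma bounded_lipschitz_skew_system
    (B : X -> 'M[R]_n) (x y : 'I_n -> X -> R) (u v : 'I_n -> R) :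
  (forall q, S q -> forall i k, B q i k = B q k i) ->
  (forall i k, bounded_lipschitz (fun q => B q i k)) ->
  (forall q, S q -> forall i, x i q - z * (\sum_k B q i k * y k q) = u i) ->
  (forall q, S q -> forall i, y i q + z * (\sum_k B q i k * x k q) = v i) ->
  forall i, bounded_lipschitz (x i) /\ bounded_lipschitz (y i).
Proof.
move=> symB blB eu ev i.
have [|CB CB0 lipB] :=
  bounded_lipschitz_uniform _ (fun (ik : 'I_n * 'I_n) q => B q ik.1 ik.2).
  by move=> ik; apply: blB.
pose s : R := \sum_k (`|u k| + `|v k|).
have bd q : S q -> forall k, `|x k q| <= s /\ `|y k q| <= s.
  move=> Sq; exact: (skew_system_bound (B q) (x^~ q) (y^~ q) u v (symB q Sq) (eu q Sq) (ev q Sq)).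
have s0 : 0 <= s by apply: sumr_ge0 => k _; rewrite addr_ge0.
(* Entries of [B] vary by at most [CB * d q q'] and solutions are bounded by [s]; the two summands
   are for the two halves of the perturbed data. *)
pose L : R := \sum_(k < n) (`|z| * (\sum_(m < n) CB * s) + `|z| * (\sum_(m < n) CB * s)).
have L0 : 0 <= L.
  by apply: sumr_ge0 => k _; rewrite addr_ge0 ?mulr_ge0 ?sumr_ge0 // => m _;
    rewrite mulr_ge0.
suff lip q q' : S q -> S q' -> E q q' ->
    `|x i q - x i q'| <= L * d q q' /\ `|y i q - y i q'| <= L * d q q'.
  by split; exists (s + L); rewrite ?addr_ge0 //;
    split=> [q Sq|q q' Sq Sq' Eqq'];
    rewrite ?mulrDl; have [] := bd q Sq i;
    try (have [] := lip q q' Sq Sq' Eqq'; have := mulr_ge0 s0 (d_ge0 q q'));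
    lra.
move=> Sq Sq' Eqq'.
have dB (w : 'I_n -> R) : (forall k, `|w k| <= s) -> forall k,
    `|z * \sum_m (B q k m - B q' k m) * w m| <=
    `|z| * (\sum_(m < n) CB * s) * d q q'.
  move=> ws k; rewrite normrM -mulrA ler_wpM2l // big_distrl.
  apply: le_trans (ler_norm_sum _ _ _) _; apply: ler_sum => m _ /=.
  rewrite normrM [leRHS]mulrAC ler_pM //.
  by have [_] := lipB (k, m); apply.
(* Data of the difference system: the change of [B] applied to the solution at [q']. *)
pose u' k := z * \sum_m (B q k m - B q' k m) * y m q'.
pose v' k := - (z * \sum_m (B q k m - B q' k m) * x m q').
have lipi := skew_system_bound (B q) (fun k => x k q - x k q')
  (fun k => y k q - y k q') u' v' (symB q Sq) _ _ i.
have le_L : \sum_k (`|u' k| + `|v' k|) <= L * d q q'.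
  rewrite big_distrl; apply: ler_sum => k _; rewrite /= mulrDl /v' normrN.
  by apply: lerD; apply: dB => m; have [] := bd q' Sq' m.
have sumBB (f g : 'I_n -> R) k : \sum_m B q k m * (f m - g m) =
    \sum_m B q k m * f m - \sum_m B q' k m * g m
    - \sum_m (B q k m - B q' k m) * g m.
  by rewrite -!sumrB; apply: eq_bigr => m _; ring.
have [||hx hy] := lipi.
- move=> k; rewrite sumBB /u'.
  have := eu q Sq k; have := eu q' Sq' k; set a := \sum_m _; set a' := \sum_m _ * y m q.
  by move=> h' h; rewrite !mulrBr; move: h h'; lra.
- move=> k; rewrite sumBB /v'.
  have := ev q Sq k; have := ev q' Sq' k; set a := \sum_m _; set a' := \sum_m _ * x m q.
  by move=> h' h; rewrite !mulrBr; move: h h'; lra.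
by split; [apply: le_trans hx _|apply: le_trans hy _].
Qed.

End SkewSystem.
End BoundedLipschitz.

(** * Complex linear systems in real and imaginary parts *)

Lemma sqr_normcE (R : realType) (a : R[i]) :
  Normc.normc a ^+ 2 = complex.Re a ^+ 2 + complex.Im a ^+ 2.
Proof. by case: a => x y; rewrite /= sqr_sqrtr // addr_ge0 ?sqr_ge0. Qed.

Lemma Re_sum (R : realType) (I : finType) (f : I -> R[i]) :
  complex.Re (\sum_i f i) = \sum_i complex.Re (f i).
Proof. by apply: (big_morph (@complex.Re R)) => // -[? ?] [? ?]. Qed.

Lemma Im_sum (R : realType) (I : finType) (f : I -> R[i]) :
  complex.Im (\sum_i f i) = \sum_i complex.Im (f i).
Proof. by apply: (big_morph (@complex.Im R)) => // -[? ?] [? ?]. Qed.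

(** As [z] and [B] are real, the factor ['i] exchanges real and imaginary parts up to sign. This
    puts a complex equation into the shape of the real skew system. *)
Lemma skew_mulmx_ReIm (R : realType) (n m : nat) (z : R) (B : 'M[R]_n)
    (W : 'M[R[i]]_(n, m)) i j :
  let V := W + ('i%C * (z%:C)%C) *: (map_mx (real_complex R) B *m W) in
  complex.Re (W i j) - z * (\sum_k B i k * complex.Im (W k j))
    = complex.Re (V i j) /\
  complex.Im (W i j) + z * (\sum_k B i k * complex.Re (W k j))
    = complex.Im (V i j).
Proof.
rewrite /= !mxE.
have [-> ->] :
    \sum_k B i k * complex.Im (W k j)
      = complex.Im (\sum_k map_mx (real_complex R) B i k * W k j) /\
    \sum_k B i k * complex.Re (W k j)
      = complex.Re (\sum_k map_mx (real_complex R) B i k * W k j).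
  rewrite Re_sum Im_sum; split; apply: eq_bigr => k _; rewrite mxE;
    by case: (W k j) => a b /=; ring.
case: (W i j) => a b; case: (\sum_k _) => a' b' /=.
by split; ring.
Qed.

(** A kernel vector solves the skew system with zero data, and the a priori bound makes it zero. *)
Lemma unitmx_1Di_sym (R : realType) (n : nat) (z : R) (B : 'M[R]_n) :
  (forall i k, B i k = B k i) ->
  1%:M + ('i%C * (z%:C)%C) *: map_mx (real_complex R) B \in unitmx.
Proof.
move=> symB; rewrite -row_free_unit -kermx_eq0; apply/rowV0P => v /sub_kermxP.
(* Kernel vectors are rows; transposing makes them columns and leaves the symmetric matrix
   unchanged. *)
move/(congr1 trmx); rewrite trmx_mul trmx0 linearD /= trmx1 linearZ /=.
have -> : (map_mx (real_complex R) B)^T = map_mx (real_complex R) B.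
  by apply/matrixP => i k; rewrite !mxE symB.
rewrite mulmxDl mul1mx -scalemxAl => v0.
have sys i := skew_mulmx_ReIm _ _ _ z B v^T i 0.
rewrite /= v0 in sys.
have bd := skew_system_bound _ z B (fun i => complex.Re (v^T i 0))
  (fun i => complex.Im (v^T i 0)) (fun=> 0) (fun=> 0) symB _ _.
apply/rowP => i; have [||re0 im0] := bd _ _ i.
- by move=> k; rewrite (sys k).1 mxE.
- by move=> k; rewrite (sys k).2 mxE.
rewrite normr0 addr0 in re0 im0.
rewrite big1 // !mxE !normr_le0 in re0 im0.
by apply/eqP; rewrite mxE eq_complex re0 im0.
Qed.

(** * Feasible points rebuilt from their power and bits *)

Section Network.
Context {R : realType} {N K b : nat} {D : {set 'I_(K + N) * 'I_(K + N)}}.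
Implicit Type t : conn_pair D -> 'I_b -> R.

(** [insub] decides whether the pair is connected; the default [0] is the value imposed on
    disconnected pairs. *)
Definition Bbar_of t : 'M[R]_(K + N) := \matrix_(i, j)
  if insub (i, j) is Some e then \sum_(l < b) 2 ^+ l * t e l else 0.

Definition Bmx_of (C : 'M[R]_(K + N)) : 'M[R]_(K + N) := \matrix_(i, j)
  if i == j then C i i + \sum_(n | n != i) C i n else - C i j.

Definition symmetric_bits t : Prop :=
  forall (e e' : conn_pair D) (l : 'I_b),
    val e' = ((val e).2, (val e).1) -> t e' l = t e l.

Hypothesis D_sym : forall i j : 'I_(K + N), ((i, j) \in D) = ((j, i) \in D).

Lemma Bmx_of_sym t : symmetric_bits t ->
  forall i j, Bmx_of (Bbar_of t) i j = Bmx_of (Bbar_of t) j i.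
Proof.
move=> symt i j; rewrite !mxE eq_sym; case: eqVneq => [->//|_].
congr (- _); case: insubP => [e _ eE|]; case: insubP => [e' _ e'E|] //=.
- by apply: eq_bigr => l _; rewrite (symt e' e) // eE e'E.
(* In the two mixed cases a pair is connected and its swap is not, against [D_sym]. *)
- by rewrite !inE D_sym => /negPn; move: (valP e); rewrite /= eE inE => /negbTE ->.
- by rewrite !inE => /negPn; move: (valP e'); rewrite /= e'E inE D_sym => /negbTE ->.
Qed.

Variables (Z0 PT : R).

(** [Bbar] vanishes on disconnected pairs and is read off the bits elsewhere, so estimates for [Bmx]
    reduce to estimates for the bits. *)
Lemma constraints_Bmx (x : point R b D) : common_constraints Z0 PT x ->
  Bmx x = Bmx_of (Bbar_of (bits x)).
Proof.
case=> _ offd diag disc bitsE _ _ _.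
have -> : Bbar_of (bits x) = Bbar x.
  apply/matrixP => i j; rewrite mxE; case: insubP => [e _ eE|].
    by rewrite -bitsE /= eE.
  by rewrite inE negbK => /disc.
by apply/matrixP => i j; rewrite mxE; case: eqVneq => [->|/offd].
Qed.

(** The network equation is always solvable, since [1 + 'i Z0 B] is invertible; hence bits may be
    rounded with the power kept. *)
Lemma constraints_complete (p : 'cV[R]_K) t : symmetric_bits t ->
  \sum_(k < K) p k 0 <= PT -> (forall k, 0 <= p k 0) ->
  exists z : point R b D,
    [/\ common_constraints Z0 PT z, power z = p & bits z = t].
Proof.
move=> symt pPT p0; pose B := Bmx_of (Bbar_of t).
pose M := 1%:M + ('i%C * (Z0%:C)%C) *: map_mx (real_complex R) B.
have unitM : M \in unitmx by apply: unitmx_1Di_sym => i k; apply: Bmx_of_sym.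
(* [G] stands for [Fbar + I1bar], which turns the network equation into [M *m G = 2 I1bar]. *)
pose G := invmx M *m (I1bar R N K + I1bar R N K).
exists (Point p (G - I1bar R N K) B (Bbar_of t) t); split=> //; split=> //=.
- rewrite subrK; apply/eqP; rewrite opprB addrA eq_sym subr_eq addrC.
  have -> : I1bar R N K + I1bar R N K = M *m G by rewrite mulKVmx.
  by rewrite /M mulmxDl mul1mx -scalemxAl.
- by move=> i j ij; rewrite mxE (negbTE ij).
- by move=> i; rewrite mxE eqxx.
- by move=> i j ijD; rewrite mxE insubN // inE negbK.
- by move=> e; rewrite mxE -surjective_pairing valK.
Qed.

End Network.

(** * The sum rate as a Lipschitz function of the bits *)

Section RateIsLipschitz.
Context {R : realType} {N K b : nat} {D : {set 'I_(K + N) * 'I_(K + N)}}.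
Hypothesis D_sym : forall i j : 'I_(K + N), ((i, j) \in D) = ((j, i) \in D).
Variables (Z0 PT sigma2 c : R) (H : 'M[R[i]]_(K, N)).
Hypotheses (sigma2_gt0 : 0 < sigma2) (c_gt0 : 0 < c).
Implicit Types x y z : point R b D.

(** The sum runs over the index set of the penalty, so that the two can be compared term by term. *)
Definition bits_dist x y : R :=
  \sum_(l < b) \sum_(e : conn_pair D | ((val e).1 <= (val e).2)%N)
    `|bits x e l - bits y e l|.

Definition same_power x y : Prop := power x = power y.

Lemma bits_dist_ge0 x y : 0 <= bits_dist x y.
Proof. by do 2!(apply: sumr_ge0 => ? _). Qed.

Lemma swap_conn_pair (e : conn_pair D) :
  exists e' : conn_pair D, val e' = ((val e).2, (val e).1).
Proof.
have eD : ((val e).2, (val e).1) \in connected D.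
  by have := valP e; rewrite !inE D_sym -surjective_pairing.
by exists (exist (fun ij => ij \in connected D) _ eD).
Qed.

Lemma bit_dist_le x y e l : symmetric_bits (bits x) -> symmetric_bits (bits y) ->
  `|bits x e l - bits y e l| <= bits_dist x y.
Proof.
move=> symx symy.
(* [bits_dist] sees only pairs with [i <= j]; symmetry of the bits transfers the bound to the
   others. *)
wlog le_e : e / ((val e).1 <= (val e).2)%N.
  move=> wlg; have /orP[|le_e] := leq_total (val e).1 (val e).2; first exact: wlg.
  have [e' e'E] := swap_conn_pair e.
  by rewrite -(symx e e') // -(symy e e') // wlg // e'E.
rewrite /bits_dist (bigD1 l) //= (bigD1 e) //= -addrA lerDl addr_ge0 //.
  exact: sumr_ge0.
by do 2!(apply: sumr_ge0 => ? _).
Qed.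

Notation bl := (bounded_lipschitz (@feasibleC R N K b Z0 PT c D) same_power bits_dist).
Notation d_ge0 := bits_dist_ge0.
#[local] Hint Resolve bits_dist_ge0 : core.

(** Nonnegative entries within the budget are bounded, and related points have equal powers, so the
    increment is zero. *)
Lemma bounded_lipschitz_power k : bl (fun x => power x k 0).
Proof.
exists `|PT| => //; split=> [x [Cx _]|x y _ _ ->]; last first.
  by rewrite subrr normr0 mulr_ge0 ?bits_dist_ge0.
rewrite ger0_norm ?(power_ge0 Cx) // (le_trans _ (ler_norm _)) //.
apply: le_trans (power_budget Cx); rewrite (bigD1 k) //= lerDl.
by apply: sumr_ge0 => j _; apply: (power_ge0 Cx).
Qed.

Lemma bounded_lipschitz_bits e l : bl (fun x => bits x e l).
Proof.
exists (c + 1); first by rewrite addr_ge0 // ltW.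
split=> [x [_ box]|x y [Cx _] [Cy _] _].
  by rewrite (@le_trans _ _ c) ?lerDl // ler_norml; apply: box.
apply: le_trans (bit_dist_le x y e l (bits_sym Cx) (bits_sym Cy)) _.
by rewrite ler_peMl ?bits_dist_ge0 // lerDr ltW.
Qed.

Lemma bounded_lipschitz_Bmx i j : bl (fun x => Bmx x i j).
Proof.
have blBbar p q : bl (fun x => Bbar_of (bits x) p q).
  (* Connectedness of [(p, q)] does not depend on [x], so one case split serves all points. *)
  pose o : option (conn_pair D) := insub (p, q).
  apply: (@bounded_lipschitz_ext _ _ _ _ _ (fun x =>
      if o is Some e then \sum_(l < b) 2 ^+ l * bits x e l else 0)).
    by move=> x _; rewrite mxE.
  case: o => [e|]; last exact: bounded_lipschitz_cst.
  apply: bounded_lipschitz_sum => // l.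
  apply: bounded_lipschitzM => //; first exact: bounded_lipschitz_cst.
  exact: bounded_lipschitz_bits.
apply: (@bounded_lipschitz_ext _ _ _ _ _ (fun x => Bmx_of (Bbar_of (bits x)) i j)).
  by move=> x [Cx _]; rewrite (constraints_Bmx Z0 PT x Cx).
have [->|ij] := eqVneq i j; last first.
  apply: bounded_lipschitz_ext (bounded_lipschitzN _ _ _ d_ge0 _ (blBbar i j)) => x _.
  by rewrite [in RHS]mxE (negbTE ij).
apply: (@bounded_lipschitz_ext _ _ _ _ _ (fun x => Bbar_of (bits x) j j
    + \sum_(n | n != j) Bbar_of (bits x) j n)).
  by move=> x _; rewrite [in RHS]mxE eqxx.
by apply: bounded_lipschitzD => //; apply: bounded_lipschitz_sum.
Qed.

(** Each column of [Fbar + I1bar] solves the skew system of [Bmx] with the fixed data [2 I1bar]. *)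
Lemma bounded_lipschitz_Fbar i j :
  bl (fun x => complex.Re (Fbar x i j)) /\ bl (fun x => complex.Im (Fbar x i j)).
Proof.
pose G x := Fbar x + I1bar R N K; pose I2 := I1bar R N K + I1bar R N K.
have sys x : feasibleC Z0 PT c x -> forall p,
    complex.Re (G x p j) - Z0 * (\sum_k Bmx x p k * complex.Im (G x k j))
      = complex.Re (I2 p j) /\
    complex.Im (G x p j) + Z0 * (\sum_k Bmx x p k * complex.Re (G x k j))
      = complex.Im (I2 p j).
  case=> Cx _ p; have := skew_mulmx_ReIm R _ _ Z0 (Bmx x) (G x) p j.
  by rewrite /= (network_eq Cx) (_ : G x + _ = I2) // /G addrC addrA subrK.
have [||||blRe blIm] := bounded_lipschitz_skew_system (@feasibleC R N K b Z0 PT c D) same_power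
    bits_dist d_ge0 _ Z0 (@Bmx R N K b D)
    (fun p x => complex.Re (G x p j)) (fun p x => complex.Im (G x p j))
    (fun p => complex.Re (I2 p j)) (fun p => complex.Im (I2 p j)) _ _ _ _ i.
- move=> x [Cx _] p k; rewrite (constraints_Bmx Z0 PT x Cx).
  exact: Bmx_of_sym (bits_sym Cx) _ _.
- exact: bounded_lipschitz_Bmx.
- by move=> x Sx p; have [] := sys x Sx p.
- by move=> x Sx p; have [] := sys x Sx p.
have eqG x : Fbar x i j = G x i j - I1bar R N K i j by rewrite /G mxE addrK.
split.
  apply: bounded_lipschitz_ext (bounded_lipschitzB _ _ _ d_ge0 _ _ blRe
    (bounded_lipschitz_cst _ _ _ d_ge0 (complex.Re (I1bar R N K i j)))) => x _.
  by rewrite eqG; case: (G x i j) (I1bar _ _ _ _ _) => ? ? [].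
apply: bounded_lipschitz_ext (bounded_lipschitzB _ _ _ d_ge0 _ _ blIm
  (bounded_lipschitz_cst _ _ _ d_ge0 (complex.Im (I1bar R N K i j)))) => x _.
by rewrite eqG; case: (G x i j) (I1bar _ _ _ _ _) => ? ? [].
Qed.

Lemma bounded_lipschitz_gain k j : bl (fun x => gain H (Fbar x) k j).
Proof.
pose h := row k H *m I2bar R N K.
(* Real and imaginary parts of the received amplitude; the gain is the sum of their squares. *)
pose re x := \sum_r (complex.Re (h 0 r) * complex.Re (Fbar x r j)
                     - complex.Im (h 0 r) * complex.Im (Fbar x r j)).
pose im x := \sum_r (complex.Re (h 0 r) * complex.Im (Fbar x r j)
                     + complex.Im (h 0 r) * complex.Re (Fbar x r j)).
have cst a : bl (fun=> a) by apply: bounded_lipschitz_cst.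
have blre : bl re.
  apply: bounded_lipschitz_sum => // r; have [? ?] := bounded_lipschitz_Fbar r j.
  by apply: bounded_lipschitzB => //; apply: bounded_lipschitzM.
have blim : bl im.
  apply: bounded_lipschitz_sum => // r; have [? ?] := bounded_lipschitz_Fbar r j.
  by apply: bounded_lipschitzD => //; apply: bounded_lipschitzM.
apply: (@bounded_lipschitz_ext _ _ _ _ _ (fun x => re x * re x + im x * im x)).
  move=> x _; rewrite /gain sqr_normcE mxE Re_sum Im_sum !expr2.
  by congr (_ * _ + _ * _); apply: eq_bigr => r _; rewrite [col _ _ _ _]mxE /h;
    case: (_ 0 r) (Fbar x r j) => ? ? [].
by apply: bounded_lipschitzD => //; apply: bounded_lipschitzM.
Qed.

(** Denominators stay above [sigma2] and arguments of the logarithms above [1], so the rules for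
    inverse and logarithm apply. *)
Lemma bounded_lipschitz_objectiveD : bl (@objectiveD R N K b sigma2 H D).
Proof.
apply: bounded_lipschitz_sum => // k.
have gp0 x j : feasibleC Z0 PT c x -> 0 <= gain H (Fbar x) k j * power x j 0.
  by case=> Cx _; apply: mulr_ge0 (sqr_ge0 _) (power_ge0 Cx _).
have blgp j : bl (fun x => gain H (Fbar x) k j * power x j 0).
  apply: bounded_lipschitzM => //; first exact: bounded_lipschitz_gain.
  exact: bounded_lipschitz_power.
have den x : feasibleC Z0 PT c x -> sigma2 <=
    \sum_(j < K | j != k) gain H (Fbar x) k j * power x j 0 + sigma2.
  by move=> Sx; rewrite lerDr sumr_ge0 // => j _; apply: gp0.
apply: bounded_lipschitzM => //; last exact: bounded_lipschitz_cst.
apply: bounded_lipschitz_ln => //.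
  move=> x Sx; rewrite lerDl divr_ge0 ?gp0 //.
  exact: le_trans (ltW sigma2_gt0) (den x Sx).
apply: bounded_lipschitzD => //; first exact: bounded_lipschitz_cst.
apply: bounded_lipschitzM => //.
apply: bounded_lipschitzV den _ => //.
apply: bounded_lipschitzD => //; last exact: bounded_lipschitz_cst.
exact: bounded_lipschitz_sum.
Qed.

(** * Rounding and the penalty threshold *)

Lemma feasibleD_feasibleC x : feasibleD Z0 PT c x -> feasibleC Z0 PT c x.
Proof.
case=> Cx binx; split=> // e l; have := c_gt0.
by case: (binx e l) => -> ?; apply/andP; split; lra.
Qed.

Lemma objectiveC_binary rho x : bits_binary c x ->
  objectiveC sigma2 c H rho x = objectiveD sigma2 H x.
Proof.
move=> binx; rewrite /objectiveC big1 ?mulr0 ?addr0 // => l _.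
by apply: big1 => e _; case: (binx e l) => ->; rewrite ?sqrrN subrr.
Qed.

Lemma rounding x : feasibleC Z0 PT c x -> exists z,
  [/\ feasibleD Z0 PT c z, same_power x z,
      forall e l, c * `|bits x e l - bits z e l| <= c ^+ 2 - bits x e l ^+ 2 &
      bits_dist x z = 0 -> bits_binary c x].
Proof.
(* A zero bit goes to [c]; rounding depends on the value alone and so preserves symmetry. *)
case=> Cx box; pose t e l := if 0 <= bits x e l then c else - c.
have [|z [Cz pz tz]] := constraints_complete D_sym Z0 PT (power x) t _
    (power_budget Cx) (power_ge0 Cx).
  by move=> e e' l ee'; rewrite /t (bits_sym Cx l ee').
have binz : bits_binary c z.
  by move=> e l; rewrite tz /t; case: ifP => _; [right|left].
exists z; split=> // [e l|d0 e l].
  (* A bit [s] moves by [c - |s|], and [c (c - |s|) <= (c + |s|) (c - |s|)]. *)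
  have /andP[lo hi] := box e l; rewrite tz /t.
  case: (lerP 0 (bits x e l)) => sgn.
    by rewrite ler0_norm ?subr_le0 //; nra.
  by rewrite ger0_norm ?opprK; nra.
have := bit_dist_le x z e l (bits_sym Cx) (bits_sym Cz).
by rewrite d0 normr_le0 subr_eq0 => /eqP ->.
Qed.

(** Strict improvement at non-binary points is stated contrapositively, which is the form used for
    optimal points of the penalty problem. *)
Lemma rounding_improves : exists2 rho_bar, 0 < rho_bar & forall rho x,
  rho_bar < rho -> feasibleC Z0 PT c x -> exists2 z : point R b D, feasibleD Z0 PT c z &
    objectiveC sigma2 c H rho x <= objectiveC sigma2 c H rho z /\
    (objectiveC sigma2 c H rho z <= objectiveC sigma2 c H rho x ->
     bits_binary c x).
Proof.
have [L L0 [_ lip]] := bounded_lipschitz_objectiveD.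
(* The extra [1] keeps the threshold positive when [L = 0] and leaves the slack [c] in
   [rho * c - 2 * L]. *)
exists (2 * L / c + 1); first by rewrite ltr_pwDr // divr_ge0 ?mulr_ge0 // ltW.
move=> rho x rho_big Cx; have [z [Dz Exz pen bin]] := rounding x Cx.
exists z => //; rewrite (objectiveC_binary rho z (proj2 Dz)) /objectiveC.
set P := \sum_(l < b) _; set d := bits_dist x z in bin *.
have d0 : 0 <= d by apply: bits_dist_ge0.
have leP : P <= - (c * d).
  rewrite /P /d /bits_dist mulr_sumr -sumrN; apply: ler_sum => l _.
  rewrite mulr_sumr -sumrN; apply: ler_sum => e _.
  by rewrite lerNr opprB pen.
have rho_c : c < rho * c - 2 * L.
  have : (2 * L / c + 1) * c < rho * c by rewrite ltr_pM2r.
  rewrite mulrDl mul1r divfK ?gt_eqF //; lra.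
have rho0 : 0 <= rho / 2.
  rewrite divr_ge0 // ltW // (lt_trans _ rho_big) //.
  by rewrite ltr_pwDr // divr_ge0 ?mulr_ge0 // ltW.
have := lip x z Cx (feasibleD_feasibleC z Dz) Exz; rewrite -/d.
set ox := objectiveD _ _ x; set oz := objectiveD _ _ z => lipxz.
have dif : ox - oz <= L * d by apply: le_trans (ler_norm _) lipxz.
(* The rate loses at most [L * d] while the penalty term gains at least [rho / 2 * c * d]. *)
have gap : c / 2 * d <= oz - (ox + rho / 2 * P).
  have h1 : rho / 2 * P <= rho / 2 * - (c * d) by rewrite ler_wpM2l.
  have h2 : 0 <= (rho * c - 2 * L - c) * d by rewrite mulr_ge0 // subr_ge0 ltW.
  lra.
have gap0 : 0 <= c / 2 * d by rewrite mulr_ge0 // divr_ge0 // ltW.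
split; first lra.
(* Without strict improvement the gap forces [d = 0]: rounding moved no bit. *)
move=> le_zx; apply: bin; apply/eqP; rewrite eq_le d0 andbT.
rewrite -(@pmulr_rle0 _ (c / 2)) ?divr_gt0 //; lra.
Qed.

End RateIsLipschitz.

Theorem theorem1 (R : realType) (N K b : nat)
    (N_gt0 : (0 < N)%N) (K_gt0 : (0 < K)%N) (b_gt0 : (0 < b)%N)
    (Z0 PT sigma2 c : R)
    (Z0_gt0 : 0 < Z0) (PT_gt0 : 0 < PT) (sigma2_gt0 : 0 < sigma2)
    (c_gt0 : 0 < c)
    (H : 'M[R[i]]_(K, N))
    (D : {set 'I_(K + N) * 'I_(K + N)})
    (D_offdiag : forall i j : 'I_(K + N), (i, j) \in D -> i != j)
    (D_sym : forall i j : 'I_(K + N), ((i, j) \in D) = ((j, i) \in D))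
    (io_connected : exists (k0 : 'I_K) (r0 : 'I_N),
       (lshift N k0, rshift K r0) \in connected D) :
  exists rho_bar : R, 0 < rho_bar /\
    forall rho : R, rho_bar < rho ->
      (forall x : point R b D,
         optimalD Z0 PT sigma2 c H x -> optimalC Z0 PT sigma2 c H rho x) /\
      (forall x : point R b D,
         optimalC Z0 PT sigma2 c H rho x ->
         (forall (e : conn_pair D) (l : 'I_b),
            bits x e l = - c \/ bits x e l = c) /\
         optimalD Z0 PT sigma2 c H x).
Proof.
have [rho_bar rho_bar0 improve] :=
  rounding_improves D_sym Z0 PT sigma2 c H sigma2_gt0 c_gt0 (b := b).
exists rho_bar; split=> // rho rho_big; split=> x [Fx optx].
  split; first exact: feasibleD_feasibleC.
  (* A competitor [y] is dominated by its rounding [z], which competes with [x] in the discrete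
     problem, where both objectives agree. *)
  move=> y /(improve rho y rho_big)[z Dz [le_yz _]]; apply: le_trans le_yz _.
  rewrite (objectiveC_binary _ _ _ _ _ (proj2 Fx)).
  by rewrite (objectiveC_binary _ _ _ _ _ (proj2 Dz)); apply: optx.
have [z Dz [_ bin]] := improve rho x rho_big Fx.
(* By optimality [x] is not beaten by its own rounding, hence it is binary. *)
have binx : bits_binary c x.
  by apply: bin; apply: optx; apply: feasibleD_feasibleC.
split=> //; split=> [|y Dy]; first by case: Fx.
rewrite -(objectiveC_binary _ _ _ rho _ binx).
rewrite -(objectiveC_binary _ _ _ rho _ (proj2 Dy)).
by apply: optx; apply: feasibleD_feasibleC.
Qed.
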